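(* Let $v, d$ be positive integers with $d < v$ and let $W \in \mathbb{R}^{v\times d}$ be a matrix of full rank $d$ (the softmax matrix of an LLM). Regard the simplex $\Delta_v$ as a $(v-1)$-dimensional real vector space under the operations given in the context. Then there is a linear subspace $S$ of $\Delta_v$ with $\dim S = d$ such that for every embedding $h \in \mathbb{R}^d$ the next-token probability distribution $p = \operatorname{softmax}(W h)$ belongs to $S$.
   Context: A language model (LLM) with vocabulary size $v$ and embedding size $d$ produces, on any input, an embedding $h \in \mathbb{R}^d$; its logits are $\ell = W h \in \mathbb{R}^v$, where $W \in \mathbb{R}^{v\times d}$ is a fixed matrix called the softmax matrix, and its next-token distribution is $p = \operatorname{softmax}(\ell)$, where $\operatorname{softmax}(\ell)_i = \exp(\ell_i) / \sum_{j=1}^v \exp(\ell_j)$. $\Delta_v$ denotes the set of $v$-tuples $p = (p_1,\dots,p_v)$ of real numbers strictly between $0$ and $1$ (for $v \ge 2$) with $\sum_i p_i = 1$. It is a real vector space of dimension $v-1$ under the (Aitchison) operations: addition $p \oplus q = \frac{1}{\sum_j p_j q_j}(p_1 q_1, \dots, p_v q_v)$ and scalar multiplication $\lambda \odot p = \frac{1}{\sum_j p_j^\lambda}(p_1^\lambda, \dots, p_v^\lambda)$ for $\lambda \in \mathbb{R}$, with zero vector $(1/v,\dots,1/v)$. ''Linear subspace'' and ''dimension'' in $\Delta_v$ refer to this structure. *)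

(* Defs.v *)
From HB Require Import structures.
From mathcomp Require Import all_boot all_order all_algebra.
From mathcomp Require Import mathcomp_extra boolp classical_sets reals sequences exp.

Set Implicit Arguments.
Unset Strict Implicit.
Unset Printing Implicit Defensive.

Import Order.TTheory GRing.Theory Num.Theory.

Local Open Scope ring_scope.

Definition in_simplex (R : realType) (v : nat) (p : 'cV[R]_v) : bool :=
  [forall i, 0 < p i 0 < 1] && (\sum_i p i 0 == 1).

Record simplex (R : realType) (v : nat) := Simplex {
  simplex_val :> 'cV[R]_v;
  _ : in_simplex simplex_val
}.

HB.instance Definition _ (R : realType) (v : nat) :=
  [isSub for @simplex_val R v].
HB.instance Definition _ (R : realType) (v : nat) :=
  [Choice of simplex R v by <:].

Definition normalize (R : realType) (v : nat) (u : 'cV[R]_v) : 'cV[R]_v :=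
  \col_i (u i 0 / \sum_j u j 0).

Lemma simplex_gt0 (R : realType) (v : nat) (p : simplex R v) i : 0 < p i 0.
Proof. by case: p => p /= /andP[/forallP/(_ i)/andP[]]. Qed.

Lemma simplex_sum1 (R : realType) (v : nat) (p : simplex R v) :
  \sum_i p i 0 = 1.
Proof. by case: p => p /= /andP[_ /eqP]. Qed.

(* The open simplex with coordinates in ]0, 1[ is empty for v <= 1, so the
   vector space structure is put on simplex R n.+2, i.e. v = n.+2 >= 2. *)
Section Aitchison.
Context {R : realType} {n : nat}.
Implicit Types (u l : 'cV[R]_n.+2) (p q : simplex R n.+2) (a : R).

Lemma sum_gt0 u : (forall i, 0 < u i 0) -> 0 < \sum_i u i 0.
Proof.
move=> u0; rewrite (bigD1 ord0) //= ltr_wpDr //.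
by apply: sumr_ge0 => i _; exact: ltW.
Qed.

Lemma normalize_in_simplex u :
  (forall i, 0 < u i 0) -> in_simplex (normalize u).
Proof.
move=> u0; have s0 := sum_gt0 u0; apply/andP; split.
  apply/forallP => i; rewrite mxE divr_gt0 //= ltr_pdivrMr // mul1r.
  have [j ji] : exists j : 'I_n.+2, j != i.
    by exists (lift i ord0); rewrite eq_sym neq_lift.
  rewrite (bigD1 i) //= ltrDl (bigD1 j) //= ltr_wpDr //.
  by apply: sumr_ge0 => k _; exact: ltW.
under eq_bigr do rewrite mxE.
by rewrite -mulr_suml mulfV // gt_eqF.
Qed.

Lemma add_subproof p q i : 0 < (\col_j (p j 0 * q j 0) : 'cV[R]_n.+2) i 0.
Proof. by rewrite mxE mulr_gt0 // simplex_gt0. Qed.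

Definition aitchison_add p q : simplex R n.+2 :=
  Simplex (normalize_in_simplex (add_subproof p q)).

Lemma scale_subproof a p i : 0 < (\col_j (p j 0 `^ a) : 'cV[R]_n.+2) i 0.
Proof. by rewrite mxE powR_gt0 // simplex_gt0. Qed.

Definition aitchison_scale a p : simplex R n.+2 :=
  Simplex (normalize_in_simplex (scale_subproof a p)).

Lemma zero_subproof : in_simplex (const_mx n.+2%:R^-1 : 'cV[R]_n.+2).
Proof.
apply/andP; split.
  apply/forallP => i; rewrite mxE invr_gt0 ltr0n /= invf_lt1 ?ltr0n //.
  by rewrite ltr1n.
under eq_bigr do rewrite mxE.
by rewrite sumr_const card_ord -[eqbLHS]mulr_natr mulVf // pnatr_eq0.
Qed.

Definition aitchison_zero : simplex R n.+2 := Simplex zero_subproof.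

Definition aitchison_opp p : simplex R n.+2 := aitchison_scale (-1) p.

Lemma softmax_subproof l i : 0 < (map_mx (@expR R) l) i 0.
Proof. by rewrite mxE expR_gt0. Qed.

Definition softmax l : simplex R n.+2 :=
  Simplex (normalize_in_simplex (softmax_subproof l)).

(* Additive log-ratio coordinates; they transport the laws of 'rV_n.+1. *)
Definition alr p : 'rV[R]_n.+1 :=
  \row_i (ln (p (lift ord0 i) 0) - ln (p ord0 0)).

Definition alr_inv (r : 'rV[R]_n.+1) : simplex R n.+2 :=
  softmax (\col_i (if unlift ord0 i is Some j then r 0 j else 0)).

Lemma ln_normalize u i : (forall i, 0 < u i 0) ->
  ln (normalize u i 0) = ln (u i 0) - ln (\sum_j u j 0).
Proof. by move=> u0; rewrite mxE ln_div // posrE ?sum_gt0. Qed.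

Lemma alr_normalize u (u0 : forall i, 0 < u i 0) :
  alr (Simplex (normalize_in_simplex u0)) =
  \row_i (ln (u (lift ord0 i) 0) - ln (u ord0 0)).
Proof.
by apply/rowP => i; rewrite mxE [RHS]mxE /= !ln_normalize // opprB addrA subrK.
Qed.

Lemma alrD p q : alr (aitchison_add p q) = alr p + alr q.
Proof.
rewrite alr_normalize; apply/rowP => i; rewrite !mxE.
by rewrite !lnM ?posrE ?simplex_gt0 // opprD addrACA.
Qed.

Lemma alrZ a p : alr (aitchison_scale a p) = a *: alr p.
Proof.
by rewrite alr_normalize; apply/rowP => i; rewrite !mxE !ln_powR mulrBr.
Qed.

Lemma alr0 : alr aitchison_zero = 0.
Proof. by apply/rowP => i; rewrite !mxE subrr. Qed.

Lemma alr_invK : cancel alr_inv alr.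
Proof.
move=> r; rewrite alr_normalize; apply/rowP => i; rewrite !mxE !expRK.
by rewrite liftK unlift_none subr0.
Qed.

Lemma alrK : cancel alr alr_inv.
Proof.
move=> p; apply/val_inj/colP => i; rewrite !mxE.
have E j : expR (if unlift ord0 j is Some k then alr p 0 k else 0) =
    p j 0 / p ord0 0.
  case: unliftP => [k|] ->; last by rewrite expR0 divff // gt_eqF ?simplex_gt0.
  by rewrite mxE expRB !lnK // posrE simplex_gt0.
under eq_bigr do rewrite !mxE E.
rewrite E -mulr_suml simplex_sum1 mul1r invrK mulfVK //.
by rewrite gt_eqF ?simplex_gt0.
Qed.

Let alr_inj : injective alr := can_inj alrK.

Lemma aitchison_addA : associative aitchison_add.
Proof. by move=> p q r; apply: alr_inj; rewrite !alrD addrA. Qed.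

Lemma aitchison_addC : commutative aitchison_add.
Proof. by move=> p q; apply: alr_inj; rewrite !alrD addrC. Qed.

Lemma aitchison_add0 : left_id aitchison_zero aitchison_add.
Proof. by move=> p; apply: alr_inj; rewrite alrD alr0 add0r. Qed.

Lemma aitchison_addN : left_inverse aitchison_zero aitchison_opp aitchison_add.
Proof. by move=> p; apply: alr_inj; rewrite alrD alrZ alr0 scaleN1r addNr. Qed.

HB.instance Definition _ := GRing.isZmodule.Build (simplex R n.+2)
  aitchison_addA aitchison_addC aitchison_add0 aitchison_addN.

Lemma aitchison_scaleA a b p :
  aitchison_scale a (aitchison_scale b p) = aitchison_scale (a * b) p.
Proof. by apply: alr_inj; rewrite !alrZ scalerA. Qed.

Lemma aitchison_scale1 : left_id 1 aitchison_scale.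
Proof. by move=> p; apply: alr_inj; rewrite alrZ scale1r. Qed.

Lemma aitchison_scaleDr : right_distributive aitchison_scale +%R.
Proof. by move=> a p q; apply: alr_inj; rewrite !(alrD, alrZ) scalerDr. Qed.

Lemma aitchison_scaleDl p : {morph aitchison_scale^~ p : a b / a + b}.
Proof. by move=> a b; apply: alr_inj; rewrite !(alrD, alrZ) scalerDl. Qed.

HB.instance Definition _ := GRing.Zmodule_isLmodule.Build R (simplex R n.+2)
  aitchison_scaleA aitchison_scale1 aitchison_scaleDr aitchison_scaleDl.

Lemma simplex_vect_axiom : Vector.axiom n.+1 (simplex R n.+2).
Proof.
exists alr; last by exists alr_inv; [exact: alrK | exact: alr_invK].
by move=> a p q; rewrite alrD alrZ.
Qed.

HB.instance Definition _ :=
  Lmodule_hasFinDim.Build R (simplex R n.+2) simplex_vect_axiom.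

End Aitchison.

Lemma dim_simplex (R : realType) (n : nat) :
  \dim {: simplex R n.+2} = n.+1.
Proof. by rewrite dimvf. Qed.

Lemma simplex_addE (R : realType) (n : nat) (p q : simplex R n.+2) i :
  (p + q) i 0 = p i 0 * q i 0 / \sum_j p j 0 * q j 0.
Proof. by rewrite !mxE; congr (_ / _); apply: eq_bigr => j _; rewrite mxE. Qed.

Lemma simplex_scaleE (R : realType) (n : nat) (a : R) (p : simplex R n.+2) i :
  (a *: p) i 0 = p i 0 `^ a / \sum_j p j 0 `^ a.
Proof. by rewrite !mxE; congr (_ / _); apply: eq_bigr => j _; rewrite mxE. Qed.

Lemma simplex_zeroE (R : realType) (n : nat) i :
  (0 : simplex R n.+2) i 0 = n.+2%:R^-1.
Proof. by rewrite mxE. Qed.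

Lemma softmaxE (R : realType) (n : nat) (l : 'cV[R]_n.+2) i :
  softmax l i 0 = expR (l i 0) / \sum_j expR (l j 0).
Proof. by rewrite !mxE; congr (_ / _); apply: eq_bigr => j _; rewrite mxE. Qed.

(* Main.v *)
(** The log-partition term cancels in log-ratios, so softmax is linear from
    logits to the simplex and the outputs fill the image of a linear map on
    R^d. That image has dimension d - 1 when the all-ones vector lies in the
    column space of W, in which case it is enlarged to dimension d, which
    d <= dim Delta_v allows. *)
Require Import Defs.
From HB Require Import structures.
From mathcomp Require Import all_boot all_order all_algebra.
From mathcomp Require Import reals exp.

Import GRing.Theory.

Local Open Scope ring_scope.

(** Adjoin to [U] the first [k - \dim U] vectors of a basis of a complement of [U] in [V]. *)
Lemma vspace_extend_dim {K : fieldType} {vT : vectType K}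
    (U V : {vspace vT}) (k : nat) :
  (U <= V)%VS -> (\dim U <= k <= \dim V)%N ->
  exists2 S : {vspace vT}, (U <= S <= V)%VS & \dim S = k.
Proof.
move=> sUV /andP[leUk lekV].
pose X := take (k - \dim U) (vbasis (V :\: U)).
have sXD : (<<X>> <= V :\: U)%VS.
  by apply/span_subvP => x /mem_take; exact: vbasis_mem.
have dimX : \dim <<X>> = (k - \dim U)%N.
  have freeX : free X.
    have := basis_free (vbasisP (V :\: U)).
    by rewrite -{1}(cat_take_drop (k - \dim U) (vbasis _)) => /catl_free.
  (* The basis is long enough, since [k <= \dim V = \dim U + \dim (V :\: U)]. *)
  rewrite (eqnP freeX) size_takel // size_tuple.
  by rewrite leq_subLR -{1}(capv_idPr sUV) dimv_cap_compl.
exists (U + <<X>>)%VS.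
  by rewrite addvSl subv_add sUV (subv_trans sXD) ?diffvSl.
rewrite dimv_disjoint_sum ?dimX ?subnKC //.
by apply/eqP; rewrite -subv0 -(capv_diff V U) capvC capvS.
Qed.

Lemma alr_softmax (R : realType) (n : nat) (l : 'cV[R]_n.+2) :
  alr (softmax l) = \row_i (l (lift ord0 i) 0 - l ord0 0).
Proof. by rewrite alr_normalize; apply/rowP => i; rewrite !mxE !expRK. Qed.

(** [alr] is injective and carries the Aitchison operations to those of row vectors, so it suffices
    to compare differences of logits. *)
Lemma softmax_is_linear (R : realType) (n : nat) :
  linear (@softmax R n).
Proof.
move=> a l m; apply: (can_inj alrK).
rewrite alrD alrZ !alr_softmax; apply/rowP => i; rewrite !mxE.
by rewrite mulrBr opprD addrACA.
Qed.

HB.instance Definition _ (R : realType) (n : nat) :=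
  GRing.isLinear.Build R 'cV[R]_n.+2 (simplex R n.+2) _ (@softmax R n)
    (@softmax_is_linear R n).

Theorem theorem2 (R : realType) (n d : nat) (W : 'M[R]_(n.+2, d)) :
  (0 < d)%N -> (d < n.+2)%N -> \rank W = d ->
  exists S : {vspace simplex R n.+2},
    \dim S = d /\ (forall h : 'cV[R]_d, softmax (W *m h) \in S).
Proof.
move=> _ ltdv _.
pose f : 'Hom('cV[R]_d, simplex R n.+2) := linfun (@softmax R n \o mulmx W).
have [|S /andP[sfS _] dimS] := vspace_extend_dim (limg f) fullv d (subvf _).
  (* Rank-nullity gives [\dim (limg f) <= d], and [d < n.+2] gives [d <= n.+1], the dimension of the
     simplex. *)
  have dimD : \dim {: 'cV[R]_d} = d by rewrite dimvf /dim /= muln1.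
  by rewrite dim_simplex -(ltnS d) ltdv andbT -[leqRHS]dimD -(limg_ker_dim f) leq_addl.
exists S; split=> // h; apply: (subvP sfS).
by rewrite -[softmax _]/((@softmax R n \o mulmx W) h) -lfunE memv_img ?memvf.
Qed.
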